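(* Let $\mathcal{H}$ be a Hilbert space and let $(T_1,T_2,T_3)$ be any triplet in $\mathfrak{T}(\mathcal{H})$, i.e. $T_1,T_2,T_3$ are bounded linear operators on $\mathcal{H}$ with $0\leq T_1T_1^{*}+T_2T_2^{*}-T_3T_3^{*}\leq I$. Set $$T=(T_1T_1^{*}+T_2T_2^{*}-T_3T_3^{*})^{1/2}.$$ If $u$ belongs to $\mathcal{M}(T)$, then, for any $\varepsilon>0$, there exists some vector $\mathbf{z}_{\varepsilon}=(z_1(\varepsilon),z_2(\varepsilon),z_3(\varepsilon))^t$ in $\mathcal{H}\oplus\mathcal{H}\oplus\mathcal{H}$, lying in $\mathbb{T}^{\sharp}(\ker T)^{\perp}$ and hence regarded also as an element of $\mathcal{K}_0$, such that the family $(\mathbf{z}_\varepsilon)_{\varepsilon>0}$ satisfies: (i) $T_1z_1(\varepsilon)+T_2z_2(\varepsilon)-T_3z_3(\varepsilon)\to u$ as $\varepsilon\to 0$ in the strong (norm) topology of $\mathcal{H}$; (ii) $0\leq \|z_1(\varepsilon)\|_{\mathcal{H}}^2+\|z_2(\varepsilon)\|_{\mathcal{H}}^2-\|z_3(\varepsilon)\|_{\mathcal{H}}^2\uparrow \|u\|_{\mathcal{M}(T)}^2$ as $\varepsilon\downarrow 0$ (that is, this quantity is nonnegative for every $\varepsilon>0$, is nondecreasing as $\varepsilon$ decreases, and converges to $\|u\|_{\mathcal{M}(T)}^2$); (iii) $\mathbf{z}_{\varepsilon}$ converges, as $\varepsilon\to 0$, to some vector $\mathbf{z}$ in the strong (norm)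 topology of $\mathcal{K}_0$, and $u=\widetilde{\mathbb{T}}\mathbf{z}$.
   Context: For a bounded operator $A$ between Hilbert spaces, the de Branges-Rovnyak space $\mathcal{M}(A)$ is the Hilbert space consisting of all vectors in $\operatorname{ran}A$ with the pull-back norm $\|Ax\|_{\mathcal{M}(A)}=\|P_{(\ker A)^{\perp}}x\|=\min\{\|y\|:Ay=Ax\}$, where $P_{(\ker A)^\perp}$ is the orthogonal projection onto $(\ker A)^\perp$. $\mathcal{K}$ denotes the Kreĭn space $\mathcal{H}\oplus\mathcal{H}\oplus\mathcal{H}$ with the indefinite inner product $\langle \mathbf{x},\mathbf{y}\rangle_{\mathcal{K}}=\langle x_1,y_1\rangle_{\mathcal{H}}+\langle x_2,y_2\rangle_{\mathcal{H}}-\langle x_3,y_3\rangle_{\mathcal{H}}$. Define $\mathbb{T}:\mathcal{K}\to\mathcal{H}$ by $\mathbb{T}(x_1,x_2,x_3)^t=T_1x_1+T_2x_2-T_3x_3$. Its adjoint with respect to the inner products of $\mathcal{H}$ and $\mathcal{K}$ is $\mathbb{T}^{\sharp}:\mathcal{H}\to\mathcal{K}$, $\mathbb{T}^{\sharp}x=(T_1^{*}x,T_2^{*}x,T_3^{*}x)^t$. For all $x$ one has $\langle\mathbb{T}^{\sharp}x,\mathbb{T}^{\sharp}x\rangle_{\mathcal{K}}=\|Tx\|_{\mathcal{H}}^2$. Let $\mathcal{L}=(\ker T)^{\perp}=\overline{\operatorname{ran}}\,T$. Then $\mathbb{T}^{\sharp}\mathcal{L}$ with $\langle\cdot,\cdot\rangle_{\mathcal{K}}$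 is a pre-Hilbert space; $\mathcal{K}_0$ denotes its completion in the norm $\|\mathbb{T}^{\sharp}x\|_{\mathcal{K}_0}=\langle\mathbb{T}^{\sharp}x,\mathbb{T}^{\sharp}x\rangle_{\mathcal{K}}^{1/2}=\|Tx\|_{\mathcal{H}}$ $(x\in\mathcal{L})$. The restriction $\mathbb{T}^{\sharp}:\mathcal{L}\to\mathcal{K}_0$ is a bounded operator between Hilbert spaces, and $\widetilde{\mathbb{T}}:\mathcal{K}_0\to\mathcal{L}$ denotes its Hilbert space adjoint. *)

(* Defs.v *)
From HB Require Import structures.
From mathcomp Require Import all_boot all_order all_algebra.
From mathcomp Require Import all_classical all_reals all_analysis.
From mathcomp Require Import complex.
Set Implicit Arguments.
Unset Strict Implicit.
Unset Printing Implicit Defensive.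
Import Order.TTheory GRing.Theory Num.Theory.
Import numFieldNormedType.Exports.
Local Open Scope classical_set_scope.
Local Open Scope ring_scope.

(* A complex Hilbert space: a Banach space over R[i] whose norm comes from an
   inner product, linear in its first argument and conjugate-linear in its
   second one. *)
HB.mixin Record CompleteNormedModule_isHilbert (R : realType) H
    & CompleteNormedModule R[i] H := {
  inner : {dot H for (@Num.conj R[i])} ;
  sqr_norm_inner : forall x : H, `|x| ^+ 2 = inner x x
}.

#[short(type="hilbertType")]
HB.structure Definition Hilbert (R : realType) :=
  {H of CompleteNormedModule R[i] H & CompleteNormedModule_isHilbert R H}.

Notation "''[' x , y ]" := (inner x y) (format "''[' x ,  y ]") : ring_scope.

(* In a normed module over R[i] the norm takes its (real, nonnegative) values
   in R[i]; hnorm is the same norm with values in R. *)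
Definition hnorm (R : realType) (H : hilbertType R) (x : H) : R :=
  complex.Re `|x|.

Definition bounded_op (R : realType) (U V : hilbertType R) (A : U -> V) :=
  linear A /\ exists M : R, forall x, hnorm (A x) <= M * hnorm x.

(* A <= B in the Loewner order. As 0 <= c in R[i] entails that c is real, this
   includes the self-adjointness of B - A. *)
Definition op_le (R : realType) (H : hilbertType R) (A B : H -> H) :=
  forall x, 0 <= '[B x - A x, x].

Definition op_ker (R : realType) (U V : hilbertType R) (A : U -> V) : set U :=
  A @^-1` [set 0].

Definition orthocompl (R : realType) (H : hilbertType R) (W : set H) : set H :=
  [set x | forall w, W w -> '[x, w] = 0].

(* The orthogonal projection onto the closed linear subspace W. *)
Definition orthoproj (R : realType) (H : hilbertType R) (W : set H) (x : H) : H :=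
  get [set p | W p /\ orthocompl W (x - p)].

(* The Hilbert space adjoint of the bounded operator A : W -> V, where W is a
   closed linear subspace of U and A is only used on W: adjoint_on W A v is the
   Riesz representative in W of the functional x |-> '[A x, v]. *)
Definition adjoint_on (R : realType) (U V : hilbertType R) (W : set U)
    (A : U -> V) (v : V) : U :=
  get [set y | W y /\ forall x, W x -> '[A x, v] = '[x, y]].

Definition adjoint (R : realType) (U V : hilbertType R) (A : U -> V) : V -> U :=
  adjoint_on [set: U] A.

Definition op_sqrt (R : realType) (H : hilbertType R) (S : H -> H) : H -> H :=
  get [set T : H -> H | [/\ bounded_op T, op_le \0 T & T \o T = S]].

(* The de Branges-Rovnyak space M(A): its underlying set and its norm. The value
   of dbr_norm A u does not depend on the chosen preimage of u, since two of
   them differ by an element of ker A. *)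
Definition dbr_space (R : realType) (U V : hilbertType R) (A : U -> V) : set V :=
  range A.

Definition dbr_norm (R : realType) (U V : hilbertType R) (A : U -> V) (u : V) : R :=
  hnorm (orthoproj (orthocompl (op_ker A)) (get [set x | A x = u])).

(* K0, together with the embedding j of W, is a completion of the linear
   subspace W of E for the inner product ip; the values of j outside W are
   irrelevant. *)
Definition is_completion (R : realType) (E : lmodType R[i]) (ip : E -> E -> R[i])
    (W : set E) (K0 : hilbertType R) (j : E -> K0) :=
  [/\ forall (a : R[i]) x y, W x -> W y -> j (a *: x + y) = a *: j x + j y,
      forall x y, W x -> W y -> '[j x, j y] = ip x y
    & closure (j @` W) = [set: K0]].

Section Krein.
Context (R : realType) (H : hilbertType R).

Definition krein_inner (x y : H * H * H) : R[i] :=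
  '[x.1.1, y.1.1] + '[x.1.2, y.1.2] - '[x.2, y.2].

Definition row_op (T1 T2 T3 : H -> H) (x : H * H * H) : H := T1 x.1.1 + T2 x.1.2 - T3 x.2.

(* The adjoint of row_op for the inner product of H and krein_inner. *)
Definition row_op_sharp (T1 T2 T3 : H -> H) (x : H) : H * H * H :=
  (adjoint T1 x, adjoint T2 x, adjoint T3 x).

Definition gram (T1 T2 T3 : H -> H) (x : H) : H :=
  T1 (adjoint T1 x) + T2 (adjoint T2 x) - T3 (adjoint T3 x).

Definition frakT (T1 T2 T3 : H -> H) :=
  [/\ bounded_op T1, bounded_op T2, bounded_op T3,
      op_le \0 (gram T1 T2 T3) & op_le (gram T1 T2 T3) idfun].

End Krein.

(* Main.v *)
(* No functional calculus is needed. Let x0 be the preimage of u under T in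
   L = (ker T)^perp. As T is self-adjoint, T L is dense in L, and rescaling near
   preimages of x0 gives w_e in L with T w_e --> x0 and |T w_e| = |x0| / (1 + e).
   Since the Krein product of T# x and T# y is <T x, T y>, the vectors
   z_e = T# w_e satisfy q(z_e) = |T w_e|^2, and T z_e = T^2 w_e --> T x0 = u.
   The square root is obtained by iterating Y |-> (A + Y^2) / 2 from 0, with
   A = I - S: the iterates are polynomials in A with nonnegative coefficients, as
   are their increments, so they increase and converge strongly. *)
Require Import Defs.
From mathcomp Require Import all_boot all_order all_algebra.
From mathcomp Require Import all_classical all_reals all_analysis.
From mathcomp Require Import complex.
From mathcomp Require Import ring lra.
Set Implicit Arguments.
Unset Strict Implicit.
Unset Printing Implicit Defensive.
Import Order.TTheory GRing.Theory Num.Theory.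
Import numFieldNormedType.Exports.
Local Open Scope classical_set_scope.
Local Open Scope ring_scope.

(** * Real part of the inner product, and convergence in [hnorm] *)

Section RealInner.
Context (R : realType) (H : hilbertType R).
Implicit Types (x y z : H) (a : R).

(** Order, infima and limits are handled over [R]; complex identities are recovered through
    [inner_rinner]. *)
Definition rinner x y : R := complex.Re '[x, y].

Definition rscale a x : H := (a%:C)%C *: x.

Lemma hnormE x : `|x| = ((hnorm x)%:C)%C.
Proof. by rewrite /hnorm RRe_real // normr_real. Qed.

Lemma hnorm_ge0 x : 0 <= hnorm x.
Proof. by rewrite -ler0c -hnormE. Qed.

Lemma hnorm0 : hnorm (0 : H) = 0.
Proof. by rewrite /hnorm normr0. Qed.

Lemma hnorm_eq0 x : hnorm x = 0 -> x = 0.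
Proof. by move=> x0; apply/normr0_eq0; rewrite hnormE x0. Qed.

Lemma hnormN x : hnorm (- x) = hnorm x.
Proof. by rewrite /hnorm normrN. Qed.

Lemma hdistC x y : hnorm (x - y) = hnorm (y - x).
Proof. by rewrite /hnorm distrC. Qed.

Lemma ler_hnormD x y : hnorm (x + y) <= hnorm x + hnorm y.
Proof. by rewrite -lecR rmorphD /= -!hnormE ler_normD. Qed.

Lemma hnormZ a x : hnorm (rscale a x) = `|a| * hnorm x.
Proof.
apply: complexI; rewrite -hnormE normrZ hnormE rmorphM /=; congr (_ * _).
by rewrite normc_def /= expr0n addr0 sqrtr_sqr.
Qed.

Lemma innerC x y : '[x, y] = Num.conj '[y, x].
Proof. by rewrite hermC expr0 mul1r. Qed.

Lemma innerDl x y z : '[x + y, z] = '[x, z] + '[y, z].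
Proof. exact: linearDl. Qed.

Lemma innerZl (c : R[i]) x z : '[c *: x, z] = c * '[x, z].
Proof. exact: linearZl_LR. Qed.

Lemma innerDr x y z : '[z, x + y] = '[z, x] + '[z, y].
Proof. exact: linearDr. Qed.

Lemma innerZr (c : R[i]) x z : '[z, c *: x] = Num.conj c * '[z, x].
Proof. exact: linearZr_LR. Qed.

Lemma rinnerC x y : rinner x y = rinner y x.
Proof. by rewrite /rinner innerC; case: '[y, x]. Qed.

Lemma rinnerDl x y z : rinner (x + y) z = rinner x z + rinner y z.
Proof. by rewrite /rinner innerDl raddfD. Qed.

Lemma rinnerZl a x z : rinner (rscale a x) z = a * rinner x z.
Proof. by rewrite /rinner innerZl; case: '[x, z] => b c /=; rewrite mul0r subr0. Qed.

(** Conjugate-linearity in the second slot gives Re <x, iy> = Im <x, y>, so a complex identity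
    reduces to two real ones. *)
Lemma inner_rinner x y : '[x, y] = (rinner x y +i* rinner x ('i%C *: y))%C.
Proof.
by rewrite /rinner innerZr; case: '[x, y] => a b /=; congr Complex; ring.
Qed.

Lemma rinnerDr x y z : rinner z (x + y) = rinner z x + rinner z y.
Proof. by rewrite rinnerC rinnerDl !(rinnerC z). Qed.

Lemma rinnerZr a x z : rinner z (rscale a x) = a * rinner z x.
Proof. by rewrite rinnerC rinnerZl rinnerC. Qed.

Lemma rscaleN1 x : rscale (- 1) x = - x.
Proof. by rewrite /rscale rmorphN1 scaleN1r. Qed.

Lemma rinnerNl x z : rinner (- x) z = - rinner x z.
Proof. by rewrite -rscaleN1 rinnerZl mulN1r. Qed.

Lemma rinnerNr x z : rinner z (- x) = - rinner z x.
Proof. by rewrite rinnerC rinnerNl rinnerC. Qed.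

Definition rinnerE := (rinnerDl, rinnerDr, rinnerZl, rinnerZr, rinnerNl, rinnerNr).

Lemma rinner0l x : rinner 0 x = 0.
Proof. by rewrite -(subrr x) rinnerDl rinnerNl subrr. Qed.

Lemma innerxx x : '[x, x] = ((hnorm x ^+ 2)%:C)%C.
Proof. by rewrite -sqr_norm_inner hnormE rmorphXn. Qed.

Lemma rinnerxx x : rinner x x = hnorm x ^+ 2.
Proof. by rewrite /rinner innerxx. Qed.

Lemma rinner_ge0 x : 0 <= rinner x x.
Proof. by rewrite rinnerxx sqr_ge0. Qed.

Lemma rinner_eq0 x : rinner x x = 0 -> x = 0.
Proof. by rewrite rinnerxx => /eqP; rewrite sqrf_eq0 => /eqP /hnorm_eq0. Qed.

(** Real Cauchy-Schwarz, read off by expanding the squared triangle inequality. *)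
Lemma rinner_le x y : rinner x y <= hnorm x * hnorm y.
Proof.
have : hnorm (x + y) ^+ 2 <= (hnorm x + hnorm y) ^+ 2.
  by rewrite ler_sqr ?nnegrE ?addr_ge0 ?hnorm_ge0 // ler_hnormD.
rewrite -rinnerxx !rinnerE !rinnerxx (rinnerC y); lra.
Qed.

Lemma rinner_abs_le x y : `|rinner x y| <= hnorm x * hnorm y.
Proof.
by rewrite ler_norml rinner_le andbT lerNl -rinnerNl -(hnormN x) rinner_le.
Qed.

Lemma inner_eq0 x y :
  rinner x y = 0 -> rinner x ('i%C *: y) = 0 -> '[x, y] = 0.
Proof. by rewrite inner_rinner => -> ->. Qed.

Lemma inner_eq_rinner x y x' y' :
  rinner x y = rinner x' y' -> rinner x ('i%C *: y) = rinner x' ('i%C *: y') ->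
  '[x, y] = '[x', y'].
Proof. by rewrite !inner_rinner => -> ->. Qed.

(** Radii of balls live in [R[i]], but a positive element there has zero imaginary part, so real
    radii suffice. *)
Lemma hcvgP (I : Type) (F : set_system I) {FF : Filter F} (f : I -> H) (l : H) :
  f @ F --> l <->
  forall e : R, 0 < e -> \forall x \near F, hnorm (l - f x) < e.
Proof.
split=> [/cvgrPdist_lt cvf e e0|cvf].
  have e0' : 0 < (e%:C)%C by rewrite ltcR.
  by have := cvf _ e0'; apply: filterS => x; rewrite hnormE ltcR.
apply/cvgrPdist_lt => -[e i]; rewrite ltcE /= => /andP[/eqP -> e0].
by have := cvf _ e0; apply: filterS => x; rewrite hnormE ltcR.
Qed.

Lemma cauchy_hcvg (I : Type) (F : set_system I) {FF : ProperFilter F} (f : I -> H) :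
  (forall e : R, 0 < e -> exists x : I, \forall y \near F, hnorm (f x - f y) < e) ->
  exists l : H, f @ F --> l.
Proof.
move=> cf; exists (lim (f @ F)).
apply: cauchy_cvg; apply: cauchy_exP => -[e i]; rewrite ltcE /= => /andP[/eqP -> e0].
have [x fx] := cf _ e0; exists (f x); apply: filterS fx => y /= xy.
by rewrite -ball_normE /ball_ /= hnormE ltcR.
Qed.

Lemma cvg_hnorm (I : Type) (F : set_system I) {FF : Filter F} (f : I -> H) (l : H) :
  f @ F --> l -> hnorm (f x) @[x --> F] --> hnorm l.
Proof.
move=> /hcvgP cvf; apply/cvgrPdist_lt => e e0.
apply: filterS (cvf _ e0) => x; apply: le_lt_trans.
have := ler_hnormD (l - f x) (f x); have := ler_hnormD (f x - l) l.
rewrite !subrK (hdistC (f x)) ler_norml => *; apply/andP; split; lra.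
Qed.

Lemma cvg_rinner (I : Type) (F : set_system I) {FF : Filter F}
    (f g : I -> H) (l m : H) :
  f @ F --> l -> g @ F --> m -> rinner (f x) (g x) @[x --> F] --> rinner l m.
Proof.
(* Polarisation reduces the claim to convergence of norms. *)
have polar x y : rinner x y =
    ((hnorm (x + y)) ^+ 2 - hnorm x ^+ 2 - hnorm y ^+ 2) / 2.
  by rewrite -!rinnerxx !rinnerE (rinnerC y); field.
move=> fl gm; under eq_cvg do rewrite polar; rewrite polar.
by do ?[apply: cvgM|apply: cvgB|apply: cvg_hnorm|apply: cvgD|exact: cvg_cst].
Qed.

End RealInner.

(** * Riesz representation on a closed subspace *)

Section Riesz.
Context (R : realType) (H : hilbertType R).
Implicit Types (x y z : H) (a : R) (W : set H).

Definition closed_subspace W :=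
  [/\ W 0, forall (c : R[i]) x y, W x -> W y -> W (c *: x + y) & closed W].

Lemma closed_subspaceT : closed_subspace [set: H].
Proof. by split=> //; exact: closedT. Qed.

(* The representative minimises y |-> |y|^2 - 2 Re (f y) over W. *)
Lemma riesz_on W (f : H -> R[i]) (M : R) : closed_subspace W ->
  (forall c x y, f (c *: x + y) = c * f x + f y) ->
  (forall x, `|complex.Re (f x)| <= M * hnorm x) ->
  exists y, W y /\ forall x, W x -> f x = '[x, y].
Proof.
move=> [W0 Wlin Wcl] flin fM.
pose phi x := complex.Re (f x).
have phiP a x y : phi (rscale a x + y) = a * phi x + phi y.
  by rewrite /phi flin; case: (f x) (f y) => b c [d e] /=; ring.
have f0 : f 0 = 0.
  have := flin 1 0 0; rewrite scaler0 addr0 mul1r => /eqP.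
  by rewrite -subr_eq0 opprD addNKr oppr_eq0 => /eqP.
have phi0 : phi 0 = 0 by rewrite /phi f0.
have phiZ a x : phi (rscale a x) = a * phi x.
  by rewrite -[rscale a x]addr0 phiP phi0 addr0.
have phiD x y : phi (x + y) = phi x + phi y.
  by rewrite -[x in phi (x + _)]scale1r (phiP 1) mul1r.
pose J y := hnorm y ^+ 2 - 2 * phi y.
(* Completing the square: [J y] is at least (|y| - M)^2 - M^2. *)
have JM y : - M ^+ 2 <= J y.
  have := fM y; rewrite -/(phi y) ler_norml => /andP[_ ?].
  by have := sqr_ge0 (hnorm y - M); rewrite /J; nra.
have JW0 : (J @` W) (J 0) by exists 0.
have Jinf : has_inf (J @` W).
  by split; [exists (J 0)|exists (- M ^+ 2) => _ [y _ <-]].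
pose d := inf (J @` W).
have dJ y : W y -> d <= J y by move=> Wy; apply: ge_inf; [case: Jinf|exists y].
have /choice[y_ yP] n : exists y, W y /\ J y < d + n.+1%:R^-1.
  have n0 : 0 < n.+1%:R^-1 :> R by rewrite invr_gt0.
  have [_ [y Wy <-] Jy] := inf_adherent n0 Jinf.
  by exists y.
(* Parallelogram law; the linear terms of [J] cancel. *)
have hdist x y :
    hnorm (x - y) ^+ 2 = 2 * J x + 2 * J y - 4 * J (rscale 2^-1 (x + y)).
  by rewrite /J phiZ phiD -!rinnerxx !rinnerE (rinnerC y x); field.
(* Both values of [J] are within 1/(n+1) of the infimum [d], and the value at the midpoint is at
   least [d]. *)
have hn (n m : nat) : (n <= m)%N -> hnorm (y_ n - y_ m) ^+ 2 < 4 * n.+1%:R^-1.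
  move=> nm; rewrite hdist.
  have := dJ (rscale 2^-1 (y_ n + y_ m)).
  have -> : rscale 2^-1 (y_ n + y_ m) =
      ((2^-1)%:C)%C *: y_ n + (((2^-1)%:C)%C *: y_ m + 0).
    by rewrite addr0 -scalerDr.
  move=> /(_ (Wlin _ _ _ (yP n).1 (Wlin _ _ _ (yP m).1 W0))).
  have mn : m.+1%:R^-1 <= n.+1%:R^-1 :> R by rewrite lef_pV2 ?posrE // ler_nat ltnS.
  by move: mn (yP n).2 (yP m).2; move: (n.+1%:R^-1) (m.+1%:R^-1) (J _) => a b c; lra.
have [y cvy] : exists y : H, y_ @ \oo --> y.
  apply: cauchy_hcvg => e e0.
  have [N _ HN] : \forall n \near \oo, n.+1%:R^-1 < e ^+ 2 / 4 :> R.
    have := @cvg_harmonic R; move=> /cvgrPdist_lt /(_ (e ^+ 2 / 4)).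
    rewrite divr_gt0 ?exprn_gt0 // => /(_ isT); apply: filterS => n /=.
    by rewrite sub0r normrN ger0_norm ?invr_ge0.
  exists N; exists N => // m /= Nm.
  rewrite -(ltr_pXn2r (n := 2)) ?nnegrE ?hnorm_ge0 ?ltW //.
  apply: lt_trans (hn _ _ Nm) _.
  by move: (HN N (leqnn N)) => /=; move: (N.+1%:R^-1) (e ^+ 2) => a b; lra.
have Wy : W y.
  by apply: (closed_cvg _ Wcl _ _ cvy); apply: nearW => n; exact: (yP n).1.
(* First variation at the limit: [J] at t w + y_n is at least [d], hence exceeds [J (y_ n)] -
   1/(n+1); then n tends to infinity. *)
have Jy w t : W w -> 0 <= t ^+ 2 * rinner w w + 2 * t * (rinner w y - phi w).
  move=> Ww.
  have : t ^+ 2 * rinner w w + 2 * t * (rinner w (y_ n) - phi w) + n.+1%:R^-1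
      @[n --> \oo] --> t ^+ 2 * rinner w w + 2 * t * (rinner w y - phi w) + 0.
    apply: cvgD; last exact: cvg_harmonic.
    apply: cvgD; first exact: cvg_cst.
    apply: cvgMr; apply: cvgB; last exact: cvg_cst.
    by apply: cvg_rinner => //; exact: cvg_cst.
  rewrite addr0 => cv; apply: (cvgr_to_ge cv); apply: nearW => n.
  have Wn : W (rscale t w + y_ n) by apply: Wlin => //; exact: (yP n).1.
  have := dJ _ Wn; have := (yP n).2; rewrite /J phiP -!rinnerxx !rinnerE.
  rewrite (rinnerC (y_ n) w); move: (n.+1%:R^-1) => b; lra.
have key w : W w -> phi w = rinner w y.
  (* The quadratic is tested at t = -s/k, where the added 1 keeps k nonzero even for w = 0. Its
     value -s^2 (k + 1) / k^2 is nonnegative only if s = 0. *)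
  move=> Ww; pose k := rinner w w + 1; pose s := rinner w y - phi w.
  have k1 : 1 <= k by rewrite /k lerDr rinner_ge0.
  have := Jy w (- s / k) Ww; rewrite -/s.
  have -> : (- s / k) ^+ 2 * rinner w w + 2 * (- s / k) * s =
      - (s ^+ 2 * (k + 1)) / k ^+ 2.
    have -> : rinner w w = k - 1 by rewrite addrK.
    by field; rewrite gt_eqF // (lt_le_trans ltr01).
  rewrite mulNr oppr_ge0 pmulr_lle0 ?invr_gt0 ?exprn_gt0 //; last lra.
  rewrite pmulr_lle0; last lra.
  move=> s0; have : s ^+ 2 == 0 by rewrite eq_le s0 sqr_ge0.
  by rewrite sqrf_eq0 subr_eq0 => /eqP.
exists y; split=> // x Wx.
(* Real parts agree on [W]; testing at i x as well gives the imaginary parts. *)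
have Wix : W ('i%C *: x) by rewrite -[_ *: _]addr0; exact: Wlin.
have := key _ Wix; rewrite /phi -[_ *: x]addr0 flin f0 addr0 /rinner addr0 innerZl.
have := key _ Wx; rewrite /phi /rinner.
case: (f x) '[x, y] => b c [b' c'] /= ->.
by rewrite !mul0r !mul1r !sub0r => /oppr_inj ->.
Qed.

End Riesz.

(** * Bounded operators, closed subspaces, adjoints and projections *)

Section Operators.
Context (R : realType) (U V : hilbertType R).
Implicit Types (A : U -> V) (x y : U).

Lemma linearD_op A x y : linear A -> A (x + y) = A x + A y.
Proof. by move=> lA; rewrite -[x]scale1r lA !scale1r. Qed.

Lemma linear0_op A : linear A -> A 0 = 0.
Proof. by move=> lA; apply: (addIr (A 0)); rewrite -linearD_op // !add0r. Qed.

Lemma linearZ_op A (c : R[i]) x : linear A -> A (c *: x) = c *: A x.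
Proof. by move=> lA; rewrite -[c *: x]addr0 lA linear0_op // addr0. Qed.

Lemma linearN_op A x : linear A -> A (- x) = - A x.
Proof. by move=> lA; rewrite -scaleN1r linearZ_op // scaleN1r. Qed.

Lemma linearB_op A x y : linear A -> A (x - y) = A x - A y.
Proof. by move=> lA; rewrite linearD_op // linearN_op. Qed.

Lemma cvg_bounded_op A (I : Type) (F : set_system I) {FF : Filter F}
    (f : I -> U) (l : U) :
  bounded_op A -> f @ F --> l -> A (f x) @[x --> F] --> A l.
Proof.
move=> [lA [M AM]] /hcvgP cvf; apply/hcvgP => e e0.
have M1 : 0 < `|M| + 1 by rewrite ltr_wpDl.
apply: filterS (cvf _ (divr_gt0 e0 M1)) => x; rewrite ltr_pdivlMr // => xe.
rewrite -linearB_op //; apply: le_lt_trans (AM _) (le_lt_trans _ xe).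
rewrite mulrC ler_wpM2l ?hnorm_ge0 //; have := ler_norm M; lra.
Qed.

Lemma closedPcvg (W : set U) :
  (forall (F : set_system U) (l : U), ProperFilter F -> F --> l -> F W -> W l) ->
  closed W.
Proof.
move=> cW l; rewrite closureEcvg => -[F PF [Fl FW]].
by apply: (cW F) => //; apply: FW.
Qed.

Lemma inner_cvg_eq (F : set_system U) (l x y : U) (a : R) : ProperFilter F ->
  F --> l -> (\forall z \near F, rinner z x = a) -> rinner l x = a.
Proof.
move=> PF Fl Fa; have cv : rinner z x @[z --> F] --> rinner l x.
  by apply: cvg_rinner; [exact: Fl|exact: cvg_cst].
have : rinner z x @[z --> F] --> a.
  by apply: cvg_near_cst; apply: filterS Fa => z ->.
exact: (cvg_unique (@norm_hausdorff _ _) cv).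
Qed.

Lemma orthocompl_closed_subspace (W : set U) : closed_subspace (orthocompl W).
Proof.
split=> [w _|c x y Wx Wy w Ww|]; first exact: linear0l.
  by rewrite innerDl innerZl Wx // Wy // mulr0 addr0.
apply: closedPcvg => F l PF Fl FW w Ww; apply: inner_eq0.
  apply: inner_cvg_eq Fl _ => //; apply: filterS FW => z /(_ _ Ww).
  by rewrite /rinner => ->.
apply: inner_cvg_eq Fl _ => //; apply: filterS FW => z /(_ _ Ww).
by rewrite /rinner innerZr => ->; rewrite mulr0.
Qed.

Lemma op_ker_closed_subspace A : bounded_op A -> closed_subspace (op_ker A).
Proof.
move=> bA; have lA := bA.1; split=> [|c x y|]; rewrite /op_ker /=.
- exact: linear0_op.
- by move=> Ax Ay; rewrite lA Ax Ay scaler0 addr0.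
apply: closedPcvg => F l PF Fl FW.
have cv : A z @[z --> F] --> A l by apply: cvg_bounded_op; [|exact: Fl].
have : A z @[z --> F] --> (0 : V) by apply: cvg_near_cst; apply: filterS FW => z ->.
exact: (cvg_unique (@norm_hausdorff _ _) cv).
Qed.

(** [adjoint_on] is a [get]: the Riesz theorem supplies an inhabitant, so the chosen value meets its
    specification. *)
Lemma riesz_inner_on (W : set U) A (v : V) : closed_subspace W -> bounded_op A ->
  W (adjoint_on W A v) /\ forall x, W x -> '[A x, v] = '[x, adjoint_on W A v].
Proof.
move=> cW [lA [M AM]].
apply: (@getPex _ [set y | W y /\ forall x, W x -> '[A x, v] = '[x, y]]).
apply: (@riesz_on _ _ _ (fun x => '[A x, v]) (M * hnorm v)) => //.
  by move=> c x y; rewrite lA innerDl innerZl.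
move=> x; apply: le_trans (rinner_abs_le _ _) _.
by rewrite mulrAC ler_wpM2r ?hnorm_ge0.
Qed.

Lemma adjointP A x (v : V) : bounded_op A -> '[A x, v] = '[x, adjoint A v].
Proof. by move=> bA; apply: (riesz_inner_on v (@closed_subspaceT _ _) bA).2. Qed.

(** The projection of x is the Riesz representative in [W] of the functional <., x>. *)
Lemma orthoprojP (W : set U) x : closed_subspace W ->
  W (orthoproj W x) /\ orthocompl W (x - orthoproj W x).
Proof.
move=> cW; apply: (@getPex _ [set p | W p /\ orthocompl W (x - p)]).
have bid : bounded_op (idfun : U -> U).
  by split=> //; exists 1 => y; rewrite mul1r.
have [] := @riesz_on _ _ W (fun y => '[y, x]) (hnorm x) cW.
- by move=> c y z; rewrite innerDl innerZl.
- by move=> y; rewrite mulrC rinner_abs_le.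
move=> p [Wp px]; exists p; split=> // w Ww.
by rewrite innerC linearBr /= px // subrr rmorph0.
Qed.

Lemma rinner_inj x y : (forall z, rinner x z = rinner y z) -> x = y.
Proof.
move=> xy; apply/eqP; rewrite -subr_eq0; apply/eqP/rinner_eq0.
by rewrite rinnerDl rinnerNl xy subrr.
Qed.

Lemma inner_inj x y : (forall z, '[z, x] = '[z, y]) -> x = y.
Proof.
move=> xy; apply/eqP; rewrite -subr_eq0; apply/eqP/rinner_eq0.
by rewrite /rinner linearBr /= xy subrr.
Qed.

End Operators.

Section Adjoint.
Context (R : realType) (U V : hilbertType R).

Lemma adjoint_linear (A : U -> V) : bounded_op A -> linear (adjoint A).
Proof.
move=> bA c x y; apply: inner_inj => z.
by rewrite -adjointP // innerDr innerZr !adjointP // innerDr innerZr.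
Qed.
End Adjoint.

(** * Positive operators and their self-adjointness *)

Section PositiveOperators.
Context (R : realType) (H : hilbertType R).
Implicit Types (A B : H -> H) (x y : H).

Definition pos_op B := linear B /\ forall x, 0 <= '[B x, x].

Lemma op_le0P B : op_le \0 B <-> forall x, 0 <= '[B x, x].
Proof. by split=> B0 x; have := B0 x; rewrite subr0. Qed.

Lemma inner_ge0E x y :
  (0 <= '[x, y]) = (rinner x ('i%C *: y) == 0) && (0 <= rinner x y).
Proof. by rewrite inner_rinner lecE /= eq_sym. Qed.

Lemma pos_op_rinner B x : pos_op B -> 0 <= rinner (B x) x.
Proof. by move=> [_ /(_ x)]; rewrite inner_ge0E => /andP[]. Qed.

Lemma rinner_iC x y : rinner ('i%C *: x) y = - rinner x ('i%C *: y).
Proof.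
rewrite /rinner innerZl innerZr; case: '[x, y] => a b /=; ring.
Qed.

Lemma rinner_ii x y : rinner ('i%C *: x) ('i%C *: y) = rinner x y.
Proof.
by rewrite rinner_iC scalerA -expr2 sqr_i scaleN1r rinnerNr opprK.
Qed.

(* Polarisation of Im <B x, x> = 0 at x + i y. *)
Lemma pos_op_selfadjoint B x y : pos_op B -> rinner (B x) y = rinner x (B y).
Proof.
move=> [lB B0].
have Im0 z : rinner (B z) ('i%C *: z) = 0.
  by have := B0 z; rewrite inner_ge0E => /andP[/eqP].
have := Im0 (x + 'i%C *: y).
rewrite scalerDr scalerA -expr2 sqr_i scaleN1r linearD_op // linearZ_op //.
rewrite !rinnerE rinner_ii rinner_iC !Im0 (rinnerC x); lra.
Qed.

Lemma pos_op_inner B x y : pos_op B -> '[B x, y] = '[x, B y].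
Proof.
move=> pB; apply: inner_eq_rinner; first exact: pos_op_selfadjoint.
by rewrite pos_op_selfadjoint // linearZ_op //; case: pB.
Qed.

(** This is B^2 <= B for 0 <= B <= I: expand the positivity of B at x - B x and bound <B (B x), B x>
    by |B x|^2. *)
Lemma pos_op_hnorm_le B x : pos_op B ->
  (forall y, rinner (B y) y <= rinner y y) -> hnorm (B x) ^+ 2 <= rinner (B x) x.
Proof.
move=> pB B1; have := pos_op_rinner (x - B x) pB.
have lB : linear B by case: pB.
rewrite linearB_op // !rinnerE -rinnerxx (pos_op_selfadjoint (B x) x) //.
have := B1 (B x); lra.
Qed.

End PositiveOperators.

(** * Square root of a positive operator below the identity *)

Section SquareRoot.
Context (R : realType) (H : hilbertType R).
Implicit Types (A B C : H -> H) (x y : H).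

(* The polynomials in A with nonnegative coefficients. *)
Inductive cone A : (H -> H) -> Prop :=
| cone0 : cone A (fun _ => 0)
| coneS (c : R) (k : nat) B : 0 <= c -> cone A B ->
    cone A (fun x => rscale c (iter k A x) + B x).

Variable A : H -> H.
Hypothesis pA : pos_op A.

Let lA : linear A := pA.1.

Lemma linear_iter k : linear (iter k A).
Proof. by elim: k => [//|k IH] c x y; rewrite !iterS IH lA. Qed.

Lemma iter_ge0 k x : 0 <= '[iter k A x, x].
Proof.
(* Induction by steps of two: <A^(k+2) x, x> = <A^k (A x), A x>, with base cases k = 0 and k = 1. *)
elim/ltn_ind: k x => -[|[|k]] IH x /=; first 2 last.
- by rewrite pos_op_inner // -iterS iterSr IH.
- by rewrite innerxx ler0c sqr_ge0.
- exact: pA.2.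
Qed.

(** This is what the cone is for: products of positive operators need not be positive, but the cone
    is stable under sums and composition, so membership certifies positivity. *)
Lemma cone_pos B : cone A B -> pos_op B.
Proof.
elim=> [|c k {}B c0 _ [lB B0]].
  by split=> [c x y|x]; [rewrite scaler0 addr0|rewrite linear0l].
split=> [d x y|x].
  by rewrite linear_iter lB /rscale !scalerDr !scalerA addrACA (mulrC d).
by rewrite innerDl innerZl addr_ge0 // mulr_ge0 ?iter_ge0 // ler0c.
Qed.

Lemma cone_iter k : cone A (iter k A).
Proof.
have := coneS k ler01 (cone0 A).
by congr cone; apply/funext => x; rewrite /rscale scale1r addr0.
Qed.

Lemma coneD B C : cone A B -> cone A C -> cone A (fun x => B x + C x).
Proof.
move=> cB cC; elim: cB => [|c k {}B c0 _ IH].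
  by congr cone: cC; apply/funext => x; rewrite add0r.
by congr cone: (coneS k c0 IH); apply/funext => x; rewrite addrA.
Qed.

Lemma coneZ (a : R) B : 0 <= a -> cone A B -> cone A (fun x => rscale a (B x)).
Proof.
move=> a0; elim=> [|c k {}B c0 _ IH].
  by congr cone: (cone0 A); apply/funext => x; rewrite /rscale scaler0.
congr cone: (coneS k (mulr_ge0 a0 c0) IH); apply/funext => x.
by rewrite /rscale scalerDr scalerA rmorphM.
Qed.

Lemma cone_comp B C : cone A B -> cone A C -> cone A (B \o C).
Proof.
move=> + cC; elim=> [|c k {}B c0 _ IH]; first exact: cone0.
apply: (@coneD (fun x => rscale c (iter k A (C x)))) IH; apply: coneZ => //.
elim: cC => [|d l {}C d0 _ IH'].
  congr cone: (cone0 A); apply/funext => x.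
  by rewrite linear0_op //; exact: linear_iter.
congr cone: (coneS (k + l) d0 IH'); apply/funext => x.
by rewrite linear_iter iterD.
Qed.


(** A fixed point Y = (A + Y^2) / 2 satisfies (I - Y)^2 = I - A, so for A = I - S the root of S is I
    - Y. *)
Fixpoint sqrt_iter (n : nat) : H -> H :=
  if n is m.+1 then fun x => rscale 2^-1 (A x + (sqrt_iter m \o sqrt_iter m) x)
  else fun _ => 0.

Let half_ge0 : 0 <= 2^-1 :> R. Proof. by rewrite invr_ge0. Qed.

Lemma sqrt_iterS n x :
  sqrt_iter n.+1 x = rscale 2^-1 (A x + sqrt_iter n (sqrt_iter n x)).
Proof. by []. Qed.

Lemma cone_sqrt_iter n : cone A (sqrt_iter n).
Proof.
elim: n => [|n IH]; first exact: cone0.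
by apply: coneZ => //; apply: coneD; [exact: (cone_iter 1)|exact: cone_comp].
Qed.

Lemma cone_sqrt_iterS n : cone A (fun x => sqrt_iter n.+1 x - sqrt_iter n x).
Proof.
elim: n => [|n IH].
  by congr cone: (cone_sqrt_iter 1); apply/funext => x; rewrite subr0.
have [lY _] := cone_pos (cone_sqrt_iter n).
(* Y_{n+1}^2 - Y_n^2 = Y_n D + D Y_{n+1} with D = Y_{n+1} - Y_n *)
have := coneD (cone_comp (cone_sqrt_iter n) IH) (cone_comp IH (cone_sqrt_iter n.+1)).
move/(coneZ half_ge0); congr cone; apply/funext => x.
rewrite (sqrt_iterS n.+1) [X in _ = _ - X]sqrt_iterS /rscale -scalerBr.
move: (sqrt_iter n.+1) => Y; congr (_ *: _).
rewrite /= (linearB_op _ _ lY) [LHS]addrC addrA subrK.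
by rewrite opprD [RHS]addrACA subrr add0r.
Qed.

Lemma cone_sqrt_iterB n m : (n <= m)%N ->
  cone A (fun x => sqrt_iter m x - sqrt_iter n x).
Proof.
move=> /subnK <-; elim: (m - n)%N => [|k IH].
  by congr cone: (cone0 A); apply/funext => x; rewrite subrr.
congr cone: (coneD (cone_sqrt_iterS (k + n)) IH).
by apply/funext => x; rewrite addrA subrK.
Qed.

Hypothesis A1 : forall x, rinner (A x) x <= rinner x x.

(** By induction Y_n <= I, hence Y_n^2 <= Y_n <= I, and Y_{n+1} is the mean of A <= I and Y_n^2. *)
Lemma sqrt_iter_le n x : rinner (sqrt_iter n x) x <= rinner x x.
Proof.
elim: n x => [|n IH] x; first by rewrite rinner0l rinner_ge0.
have pY := cone_pos (cone_sqrt_iter n).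
rewrite /= rinnerZl rinnerDl (pos_op_selfadjoint _ _ pY) rinnerxx.
by have := pos_op_hnorm_le x pY IH; have := A1 x; have := IH x; lra.
Qed.

(** Monotone convergence: D = Y_m - Y_n satisfies 0 <= D <= Y_m <= I, so |D x|^2 <= <D x, x>, an
    increment of the bounded nondecreasing real sequence [s]. *)
Lemma sqrt_iter_cvg x : exists y : H, sqrt_iter n x @[n --> \oo] --> y.
Proof.
have pY n := cone_pos (cone_sqrt_iter n).
pose s n := rinner (sqrt_iter n x) x.
have sinc n m : (n <= m)%N ->
    hnorm (sqrt_iter m x - sqrt_iter n x) ^+ 2 <= s m - s n.
  move=> nm; have pD := cone_pos (cone_sqrt_iterB nm).
  have := pos_op_hnorm_le x pD; rewrite rinnerDl rinnerNl; apply => y.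
  rewrite rinnerDl rinnerNl lerBlDr (le_trans (sqrt_iter_le m y)) //.
  by rewrite lerDl pos_op_rinner.
have sI : has_sup (range s).
  by split; [exists (s 0), 0|exists (rinner x x) => _ [n _ <-]; exact: sqrt_iter_le].
apply: cauchy_hcvg => e e0.
have [_ [N _ <-] sN] := sup_adherent (exprn_gt0 2 e0) sI.
exists N; exists N => // m /= Nm; rewrite hdistC.
rewrite -(ltr_pXn2r (n := 2)) ?nnegrE ?hnorm_ge0 ?ltW //.
apply: le_lt_trans (sinc _ _ Nm) _.
have : s m <= sup (range s) by apply: ub_le_sup; [case: sI|exists m].
by move: sN; lra.
Qed.

End SquareRoot.

Lemma op_sqrt_exists (R : realType) (H : hilbertType R) (S : H -> H) :
  linear S -> op_le \0 S -> op_le S idfun ->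
  exists T, [/\ bounded_op T, op_le \0 T & T \o T = S].
Proof.
move=> lS /op_le0P S0 S1.
pose A x := x - S x.
have pA : pos_op A.
  split=> // c x y; rewrite /A lS scalerBr; by rewrite opprD addrACA.
have A1 x : rinner (A x) x <= rinner x x.
  by rewrite rinnerDl rinnerNl gerDl oppr_le0 pos_op_rinner.
pose Yn := sqrt_iter A.
have /choice[Y cvY] : forall x, exists y : H, Yn n x @[n --> \oo] --> y.
  exact: sqrt_iter_cvg.
have pYn n : pos_op (Yn n) := cone_pos pA (cone_sqrt_iter pA n).
have lY : linear Y.
  move=> c x y; suff : Yn n (c *: x + y) @[n --> \oo] --> c *: Y x + Y y.
    exact: (cvg_unique (@norm_hausdorff _ _) (cvY _)).
  under eq_cvg do rewrite (pYn _).1.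
  by apply: cvgD => //; apply: cvgZr.
have saY x y : rinner (Y x) y = rinner x (Y y).
  suff : rinner (Yn n x) y @[n --> \oo] --> rinner x (Y y).
    exact: (cvg_unique (@norm_hausdorff _ _) (cvg_rinner (cvY x) (cvg_cst y))).
  under eq_cvg do rewrite pos_op_selfadjoint //.
  by apply: cvg_rinner => //; exact: cvg_cst.
have Y1 x : rinner (Y x) x <= rinner x x.
  apply: (cvgr_to_le (cvg_rinner (cvY x) (cvg_cst x))).
  by apply: nearW => n; exact: sqrt_iter_le.
(* The limit is taken weakly: moving one factor of Y_n^2 onto z leaves the pairing of Y_n x with Y_n
   z, and both converge strongly. *)
have YE x : Y x = rscale 2^-1 (A x + Y (Y x)).
  apply: rinner_inj => z; rewrite rinnerZl rinnerDl (saY (Y x)).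
  suff : rinner (Yn n.+1 x) z @[n --> \oo]
      --> 2^-1 * (rinner (A x) z + rinner (Y x) (Y z)).
    rewrite (cvg_shiftS (fun n => rinner (Yn n x) z)).
    exact: (cvg_unique (@norm_hausdorff _ _) (cvg_rinner (cvY x) (cvg_cst z))).
  under eq_cvg do rewrite /Yn sqrt_iterS rinnerZl rinnerDl
    (pos_op_selfadjoint _ _ (pYn _)).
  apply: cvgMr; apply: cvgD; first exact: cvg_cst.
  exact: cvg_rinner.
pose T x := x - Y x.
have lT : linear T by move=> c x y; rewrite /T lY scalerBr opprD addrACA.
have TT x : T (T x) = S x.
  apply: rinner_inj => z; have := congr1 (fun y => rinner y z) (YE x).
  by rewrite /T linearB_op // /A !rinnerE; lra.
have saT x y : rinner (T x) y = rinner x (T y) by rewrite !rinnerE saY.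
exists T; split; last by apply/funext.
(* The bound 1 comes from |T x|^2 = <S x, x> <= |x|^2. *)
- split=> //; exists 1 => x; rewrite mul1r.
  rewrite -(ler_pXn2r (n := 2)) ?nnegrE ?hnorm_ge0 //.
  rewrite -!rinnerxx saT TT rinnerC -subr_ge0 -rinnerNl -rinnerDl.
  exact: pos_op_rinner pA.
- apply/op_le0P => x; rewrite inner_ge0E; apply/andP; split; last first.
    by rewrite rinnerDl rinnerNl subr_ge0.
  (* The imaginary part of <T x, x> equals its own opposite, since T is self-adjoint and
     multiplication by i is skew-adjoint. *)
  have := saT x ('i%C *: x); rewrite linearZ_op // => E.
  have := rinner_iC x (T x); rewrite (rinnerC _ (T x)) E => E0.
  by apply/eqP; lra.
Qed.

(** * Density of the range of a positive operator *)

Section Range.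
Context (R : realType) (H : hilbertType R).
Implicit Types (T : H -> H) (x y : H) (W : set H).

(** The difference between x and its projection on [W] is orthogonal to both, hence to itself. *)
Lemma biorthocompl W x : closed_subspace W -> orthocompl (orthocompl W) x -> W x.
Proof.
move=> cW Wx; have [Wp xp] := orthoprojP x cW.
suff -> : x = orthoproj W x by [].
apply/eqP; rewrite -subr_eq0; apply/eqP/rinner_eq0.
rewrite rinnerDl rinnerNl {1}/rinner (Wx _ xp) rinnerC {1}/rinner xp //.
by rewrite subrr.
Qed.

(** The norm closure of the range, in epsilon form. *)
Definition adherent_range T : set H :=
  [set x | forall e : R, 0 < e -> exists w, hnorm (x - T w) < e].

Lemma adherent_range_closed_subspace T :
  linear T -> closed_subspace (adherent_range T).
Proof.
move=> lT; split=> [e e0|c x y Tx Ty e e0|].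
- by exists 0; rewrite linear0_op // subr0 hnorm0.
- have c0 : 0 <= complex.Re `|c| by rewrite -ler0c RRe_real ?normr_real.
  have [|w xw] := Tx (e / 2 / (complex.Re `|c| + 1)).
    by rewrite !divr_gt0 // ltr_wpDl.
  have [|v yv] := Ty (e / 2); first by rewrite divr_gt0.
  exists (c *: w + v); rewrite lT opprD addrACA -scalerBr.
  apply: le_lt_trans (ler_hnormD _ _) _.
  have -> : hnorm (c *: (x - T w)) = complex.Re `|c| * hnorm (x - T w).
    by apply: complexI; rewrite -hnormE normrZ hnormE rmorphM; congr (_ * _).
  move: xw; rewrite ltr_pdivlMr ?ltr_wpDl // mulrDr mulr1 mulrC => xw.
  by have := hnorm_ge0 (x - T w); lra.
- apply: closedPcvg => F l PF /(@hcvgP _ _ _ _ _ id) Fl FT e e0.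
  have e2 : 0 < e / 2 by rewrite divr_gt0.
  have [z [lz Tz]] := filter_ex (filterI (Fl _ e2) FT).
  have [w zw] := Tz _ e2; exists w.
  rewrite -(subrK z l) -addrA; apply: le_lt_trans (ler_hnormD _ _) _.
  by rewrite [e](splitr e) ltrD.
Qed.

(** A vector k orthogonal to the closure of ran T has <T k, y> = <k, T y> = 0 for all y, so it lies
    in ker T; x is therefore in the double complement of that closure. *)
Lemma pos_op_range_dense T x (e : R) : pos_op T -> bounded_op T ->
  orthocompl (op_ker T) x -> 0 < e ->
  exists w, orthocompl (op_ker T) w /\ hnorm (x - T w) < e.
Proof.
move=> pT bT Lx e0; have lT := bT.1.
have TMx : adherent_range T x.
  apply: biorthocompl; first exact: adherent_range_closed_subspace.
  move=> k Mk; apply: Lx; apply: rinner_inj => y; rewrite rinner0l.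
  rewrite pos_op_selfadjoint // /rinner Mk //.
  by move=> d d0; exists y; rewrite subrr hnorm0.
have [w xw] := TMx _ e0.
have [kp wp] := orthoprojP w (op_ker_closed_subspace bT).
(* Removing the kernel component of w brings it into the complement without changing T w. *)
by exists (w - orthoproj (op_ker T) w); split => //; rewrite linearB_op // kp subr0.
Qed.

(* Near-preimages of x rescaled so that |T w| is exactly |x| / (1 + e): this
   is what makes |T w| monotone in e. *)
Lemma scaled_preimage T x (e : R) : pos_op T -> bounded_op T ->
  orthocompl (op_ker T) x -> 0 < e ->
  exists w, [/\ orthocompl (op_ker T) w, hnorm (T w) = hnorm x / (1 + e)
    & hnorm (x - T w) <= 3 * e * hnorm x].
Proof.
move=> pT bT Lx e0; have lT := bT.1.
have [L0 Llin _] := orthocompl_closed_subspace (op_ker T).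
have e1 : 0 < 1 + e by rewrite addr_gt0.
(* The case x = 0 is treated apart, as rescaling divides by |T v|. *)
have := hnorm_ge0 x; rewrite le_eqVlt => /predU1P[x0|x0].
  exists 0; rewrite linear0_op // -x0 hnorm0 mul0r mulr0 subr0; split=> //.
  by rewrite -x0.
(* This tolerance [d] makes the target norm r / (1 + e) equal to r - d. *)
pose r := hnorm x; pose d := r * e / (1 + e).
have d0 : 0 < d by rewrite !divr_gt0 ?mulr_gt0.
have dr : d < r by rewrite ltr_pdivrMr // mulrDr mulr1 ltrDr.
have de : d <= r * e.
  rewrite ler_pdivrMr //; apply: ler_peMr; last by rewrite lerDl ltW.
  by rewrite mulr_ge0 ?ltW.
have rd : r / (1 + e) = r - d by rewrite /d; field; rewrite gt_eqF.
have [v [Lv xv]] := pos_op_range_dense pT bT Lx d0.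
have h1 : r - d < hnorm (T v).
  by have := ler_hnormD (x - T v) (T v); rewrite subrK -/r; lra.
have h2 : hnorm (T v) < r + d.
  by have := ler_hnormD (T v - x) x; rewrite subrK hdistC -/r; lra.
have Tv0 : 0 < hnorm (T v) by apply: lt_trans h1; rewrite subr_gt0.
pose c := (r - d) / hnorm (T v).
have c0 : 0 <= c by rewrite divr_ge0 ?hnorm_ge0 // subr_ge0 ltW.
have Tcv : T (rscale c v) = rscale c (T v) by exact: linearZ_op.
exists (rscale c v); split.
- by rewrite -[rscale c v]addr0; exact: Llin.
- by rewrite Tcv hnormZ rd ger0_norm // divfK ?gt_eqF.
(* The error is at most |x - T v| + (|T v| - (r - d)) < d + 2 d, and d <= r e; hence the factor
   3. *)
rewrite Tcv; have -> : x - rscale c (T v) = (x - T v) + rscale (1 - c) (T v).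
  by apply: rinner_inj => y; rewrite !rinnerE; ring.
apply: le_trans (ler_hnormD _ _) _.
have c1 : c <= 1 by rewrite ler_pdivrMr // mul1r ltW.
rewrite hnormZ ger0_norm ?subr_ge0 // mulrBl mul1r divfK ?gt_eqF // -/r; lra.
Qed.

End Range.

(** * The Gram operator and the Krein form *)

Section Gram.
Context (R : realType) (H : hilbertType R) (T1 T2 T3 : H -> H).
Hypotheses (b1 : bounded_op T1) (b2 : bounded_op T2) (b3 : bounded_op T3).

(** Pulling the indefinite form back along T# gives the form of the positive operator [gram], so T#
    maps into vectors of nonnegative Krein square. *)
Lemma gram_krein x y : '[gram T1 T2 T3 x, y] =
  krein_inner (row_op_sharp T1 T2 T3 x) (row_op_sharp T1 T2 T3 y).
Proof.
by rewrite linearBl /= innerDl (adjointP _ _ b1) (adjointP _ _ b2)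
  (adjointP _ _ b3).
Qed.

Lemma gram_linear : linear (gram T1 T2 T3).
Proof.
move=> c x y; rewrite /gram !adjoint_linear // b1.1 b2.1 b3.1 scalerBr scalerDr.
by rewrite opprD [RHS]addrACA; congr (_ + _); rewrite addrACA.
Qed.
End Gram.

(** * The approximating family and its limit in [K0] *)

Theorem theorem3p1 (R : realType) (H : hilbertType R) (T1 T2 T3 : H -> H)
    (hT : frakT T1 T2 T3) :
  let T := op_sqrt (gram T1 T2 T3) in
  let Tsharp := row_op_sharp T1 T2 T3 in
  let L := orthocompl (op_ker T) in
  forall u : H, dbr_space T u ->
  exists z : R -> H * H * H,
    let q (e : R) :=
      hnorm (z e).1.1 ^+ 2 + hnorm (z e).1.2 ^+ 2 - hnorm (z e).2 ^+ 2 in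
    [/\ forall e : R, 0 < e -> (Tsharp @` L) (z e),
        row_op T1 T2 T3 (z e) @[e --> 0^'+] --> u,
        [/\ forall e : R, 0 < e -> 0 <= q e,
            forall e e' : R, 0 < e -> e <= e' -> q e' <= q e
          & q e @[e --> 0^'+] --> dbr_norm T u ^+ 2]
      & forall (K0 : hilbertType R) (j : H * H * H -> K0),
          is_completion (@krein_inner R H) (Tsharp @` L) j ->
          exists zlim : K0,
            j (z e) @[e --> 0^'+] --> zlim /\
            u = adjoint_on L (j \o Tsharp) zlim].
Proof.
move=> T Tsharp L u uT; have [b1 b2 b3 S0 S1] := hT.
have [bT T0 TT] := getPex (op_sqrt_exists (gram_linear b1 b2 b3) S0 S1).
rewrite -/(op_sqrt (gram T1 T2 T3)) -/T in bT T0 TT.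
have lT := bT.1.
have pT : pos_op T by split=> //; exact/op_le0P.
have cL : closed_subspace L := orthocompl_closed_subspace _.
have kreinE x y : krein_inner (Tsharp x) (Tsharp y) = '[T x, T y].
  by rewrite -gram_krein // -TT /= pos_op_inner.
(* The preimage of least norm: [dbr_norm T u] unfolds to [hnorm x0]. *)
pose x0 := orthoproj L (get [set x | T x = u]).
have [Lx0 Tx0] : L x0 /\ T x0 = u.
  have Tg : T (get [set x | T x = u]) = u.
    by case: uT => x _ xu; apply: (@getPex _ [set x | T x = u]); exists x.
  have [Lx kx] := orthoprojP (get [set x | T x = u]) cL; split=> //.
  have : op_ker T (get [set x | T x = u] - x0).
    by apply: biorthocompl => //; exact: op_ker_closed_subspace.
  by rewrite /op_ker /= linearB_op // Tg => /eqP; rewrite subr_eq0 => /eqP.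
pose r := hnorm x0.
(* Choice asks for a total function of e; w is set to 0 for e <= 0, where nothing is claimed. *)
have /choice[w wP] : forall e : R, exists w, 0 < e ->
    [/\ L w, hnorm (T w) = r / (1 + e) & hnorm (x0 - T w) <= 3 * e * r].
  move=> e; have [e0|e0] := ltP 0 e; last by exists 0.
  by have [w ?] := scaled_preimage pT bT Lx0 e0; exists w.
have cvTw : T (w e) @[e --> 0^'+] --> x0.
  apply/hcvgP => d d0.
  (* Below this threshold 3 e r <= e (3 r + 1) < d; the added 1 covers r = 0. *)
  have d1 : 0 < d / (3 * r + 1).
    by rewrite divr_gt0 // ltr_wpDl ?mulr_ge0 ?hnorm_ge0.
  near=> e.
  have e0 : 0 < e by near: e; exact: nbhs_right_gt.
  have [_ _ /le_lt_trans] := wP _ e0; apply.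
  have : e < d / (3 * r + 1) by near: e; exact: nbhs_right_lt.
  rewrite ltr_pdivlMr ?ltr_wpDl ?mulr_ge0 ?hnorm_ge0 //; lra.
exists (Tsharp \o w) => q.
(* [q e] is the real part of the Krein square of T# w_e, which is |T w_e|^2. *)
have qE e : 0 < e -> q e = (r / (1 + e)) ^+ 2.
  move=> e0; have [_ <- _] := wP _ e0.
  rewrite -rinnerxx /rinner -kreinE /krein_inner !raddfB !raddfD /=.
  by rewrite !innerxx.
split=> [e e0|||K0 j [jlin jinner _]].
- by have [Lw _ _] := wP _ e0; exists (w e).
- have : T (T (w e)) @[e --> 0^'+] --> T x0 by exact: cvg_bounded_op.
  rewrite Tx0; apply: cvg_trans; apply: near_eq_cvg; apply: nearW => e.
  exact: (congr1 (fun S => S (w e)) TT).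
- split=> [e e0|e e' e0 ee'|].
  + by rewrite qE ?sqr_ge0.
  + have e'0 := lt_le_trans e0 ee'; rewrite !qE //.
    have [p p'] : 0 < 1 + e /\ 0 < 1 + e' by rewrite !addr_gt0.
    rewrite ler_sqr ?nnegrE ?divr_ge0 ?hnorm_ge0 ?(ltW p) ?(ltW p') //.
    by rewrite ler_wpM2l ?hnorm_ge0 // lef_pV2 ?posrE // lerD2l.
  + have : hnorm (T (w e)) ^+ 2 @[e --> 0^'+] --> r ^+ 2.
      by apply: cvgM; exact: cvg_hnorm.
    apply: cvg_trans; apply: near_eq_cvg; near=> e.
    have e0 : 0 < e by near: e; exact: nbhs_right_gt.
    by rewrite qE //; have [_ -> _] := wP _ e0.
(* On L the map [j \o Tsharp] has the same inner products as T, so T w_e being Cauchy in H makes j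
   z_e Cauchy in [K0]. *)
have jE x y : L x -> L y -> '[j (Tsharp x), j (Tsharp y)] = '[T x, T y].
  by move=> Lx Ly; rewrite jinner ?kreinE; [|exists x|exists y].
have jdist x y : L x -> L y ->
    hnorm (j (Tsharp x) - j (Tsharp y)) = hnorm (T x - T y).
  move=> Lx Ly; apply/eqP; rewrite -(eqrXn2 (n := 2)) ?hnorm_ge0 //.
  by rewrite -!rinnerxx !rinnerE /rinner !jE.
have [zlim cvz] : exists zlim : K0, j (Tsharp (w e)) @[e --> 0^'+] --> zlim.
  apply: cauchy_hcvg => d d0.
  have d2 : 0 < d / 2 by rewrite divr_gt0.
  have near2 : \forall e \near 0^'+, 0 < e /\ hnorm (x0 - T (w e)) < d / 2.
    apply: filterI; first exact: nbhs_right_gt.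
    by have /hcvgP := cvTw; apply.
  have [a [a0 ad]] := filter_ex near2; exists a.
  apply: filterS near2 => e [e0 ed].
  have [[La _ _] [Le _ _]] := (wP _ a0, wP _ e0).
  rewrite jdist // -(subrK x0 (T (w a))) -addrA.
  apply: le_lt_trans (ler_hnormD _ _) _.
  by rewrite [d](splitr d) ltrD // hdistC.
exists zlim; split=> //.
(* In the limit <T x, T w_e> tends to <T x, x0> = <x, T x0>: thus u represents the functional that
   defines the adjoint at [zlim]. *)
have zlimE x : L x -> '[j (Tsharp x), zlim] = '[x, u].
  move=> Lx; rewrite -Tx0 -pos_op_inner //.
  (* The scalar c is taken to be 1 and i, for the real and the imaginary part. *)
  have lim (c : R[i]) :
      rinner (j (Tsharp x)) (c *: zlim) = rinner (T x) (c *: x0).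
    suff : rinner (j (Tsharp x)) (c *: j (Tsharp (w e))) @[e --> 0^'+]
        --> rinner (T x) (c *: x0).
      apply: (cvg_unique (@norm_hausdorff _ _)).
      by apply: cvg_rinner; [exact: cvg_cst|exact: cvgZr].
    have : rinner (T x) (c *: T (w e)) @[e --> 0^'+] --> rinner (T x) (c *: x0).
      by apply: cvg_rinner; [exact: cvg_cst|exact: cvgZr].
    apply: cvg_trans; apply: near_eq_cvg; near=> e.
    have e0 : 0 < e by near: e; exact: nbhs_right_gt.
    by have [Le _ _] := wP _ e0; rewrite /rinner !innerZr jE.
  by rewrite !inner_rinner lim; have := lim 1; rewrite !scale1r => ->.
have Lu : L u.
  by move=> k Tk; rewrite -Tx0 pos_op_inner // Tk linear0r.
(* The chosen representative y and u both lie in L and represent the same functional there, so u - y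
   is orthogonal to itself. *)
have [Ly yP] := @getPex _ [set y | L y /\
  forall x, L x -> '[(j \o Tsharp) x, zlim] = '[x, y]]
  (ex_intro _ u (conj Lu zlimE)).
set y := get _ in Ly yP; rewrite /adjoint_on -/y.
apply/eqP; rewrite -subr_eq0; apply/eqP/rinner_eq0.
have Luy : L (u - y).
  have [_ Llin _] := cL.
  by rewrite addrC -scaleN1r; exact: Llin.
rewrite {1}/rinner linearBr /= -zlimE // -yP //=.
by rewrite subrr.
Unshelve. all: by end_near. Qed.
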